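(* If $D$ is a strongly connected UDAF digraph, then the UDAF dimension semigroup $MS(D)/\sim_D$ of $D$ is an abelian group, with abelian group presentation $$\Big\langle V_{D^\circ}\ \Big|\ 0=-v+\sum_{w\in V_{D^\circ}}\big((v,w)\operatorname{Adj}_{D^\circ}\big)\cdot w\ \text{ for all } v\in V_{D^\circ}\Big\rangle,$$ or is the empty semigroup when $D$ has no edges.
   Context: $\mathbb N$ includes $0$; maps are written on the right of their arguments, and $p\circ q$ means first $p$, then $q$. A digraph $D=(V_D,E_D,s_D,t_D)$ consists of a vertex set, an edge set and functions $s_D,t_D:E_D\to V_D$ ($e$ is an edge from $(e)s_D$ to $(e)t_D$). A homomorphism $\phi:D_1\to D_2$ is a pair of maps $\phi_V$ on vertices, $\phi_E$ on edges compatible with $s$ and $t$; $\operatorname{Hom}(D_1,D_2)$ is the set of these. For $n\le m$ in $\mathbb Z\cup\{\pm\infty\}$, $\mathbb Z_{[n,m]}$ is the digraph with vertices the integers $i$ with $n\le i\le m$ and an edge $(i,i+1)$ from $i$ to $i+1$ whenever both are vertices. A bi-infinite walk in $D$ is an element of $\operatorname{Hom}(\mathbb Z_{[-\infty,\infty]},D)$. A UDAF digraph is a finite digraph $D$ such that for every $v\in V_D$ the number of $h\in\operatorname{Hom}(\mathbb Z_{[0,\infty]},D)$ with $(0)h_V=v$ is not $1$ and the number of $h\in\operatorname{Hom}(\mathbb Z_{[-\infty,0]},D)$ with $(0)h_V=v$ is not $1$. The core $D^\circ$ is the subdigraph of all edges and vertices occurring in bi-infinite walks in $D$. $(v,w)\operatorname{Adj}_D$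 is the number of edges from $v$ to $w$ in $D$. A walk $w\in\operatorname{Hom}(\mathbb Z_{[-\infty,0]},D)$ is rational if there are integers $n\le0$, $m\le-1$ with $(i)w_V=(i+m)w_V$ and $(i,i+1)w_E=(i+m,i+1+m)w_E$ for all $i<n$; otherwise irrational. Let $\sigma$ be the automorphism $i\mapsto i+1$ of $\mathbb Z_{[-\infty,\infty]}$. If $w$ is a bi-infinite walk in $D$ with $w\restriction_{\mathbb Z_{[-\infty,0]}}$ irrational and $n\in\mathbb Z$, let $R(w,n)=\{h\in\operatorname{Hom}(\mathbb Z_{[-\infty,\infty]},D): h\restriction_{\mathbb Z_{[-\infty,n]}}=w\restriction_{\mathbb Z_{[-\infty,n]}}\}$ and $R^u(w,n)=\{\langle\sigma\rangle\circ h:h\in R(w,n)\}$, where $\langle\sigma\rangle\circ h=\{\sigma^k\circ h:k\in\mathbb Z\}$. The sets $R^u(w,n)$ are the unindexed rays, and $(n)w_V$ is a central vertex of $R^u(w,n)$ (a ray may have several central vertices, coming from different representations). An unindexed beam is a finite union of unindexed rays. A multiset $M\in\mathbb N^{V_{D^\circ}}$ is a vertex count for an unindexed beam $B$ if $B$ is a disjoint union of unindexed rays $R_0,\dots,R_{k-1}$ having central vertices $v_0,\dots,v_{k-1}$ respectively with $(v)M=|\{i<k:v_i=v\}|$ for all $v\in V_{D^\circ}$. The relation $\sim_D$ is the equivalence relation on $\mathbb N^{V_{D^\circ}}$ generated by pairs $(M_1,M_2)$ which are both vertex counts of a common unindexed beam; it is a congruence on the additive monoid $\mathbb N^{V_{D^\circ}}$.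 $MS(D)$ is the additive semigroup generated by the indicator functions of the vertices of $D^\circ$, i.e. $\mathbb N^{V_{D^\circ}}$ without its identity $0$; the UDAF dimension semigroup of $D$ is $MS(D)/\sim_D$. *)

(* Defs.v *)
From HB Require Import structures.
From Stdlib Require Import Relations.Relation_Operators.
From mathcomp Require Import all_boot all_order all_algebra.
From mathcomp Require Import all_classical.
Set Implicit Arguments.
Unset Strict Implicit.
Unset Printing Implicit Defensive.
Import Order.TTheory GRing.Theory Num.Theory.
Local Open Scope quotient_scope.
Local Open Scope classical_set_scope.
Local Open Scope ring_scope.

Record digraph := Digraph {
  vert : Type;
  edge : Type;
  src : edge -> vert;
  tgt : edge -> vert }.

Record finDigraph := FinDigraph {
  fvert : finType;
  fedge : finType;
  fsrc : fedge -> fvert;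
  ftgt : fedge -> fvert }.

Coercion digraph_of_fin (D : finDigraph) : digraph :=
  @Digraph (fvert D) (fedge D) (@fsrc D) (@ftgt D).

Record Hom (D1 D2 : digraph) := MkHom {
  homV : vert D1 -> vert D2;
  homE : edge D1 -> edge D2;
  hom_src : forall e, src (homE e) = homV (src e);
  hom_tgt : forall e, tgt (homE e) = homV (tgt e) }.

(* As maps are written on the right, [hom_comp p q] is first p, then q. *)
Lemma hom_comp_src (D1 D2 D3 : digraph) (p : Hom D1 D2) (q : Hom D2 D3) e :
  src ((homE q \o homE p) e) = (homV q \o homV p) (src e).
Proof. by rewrite /= !hom_src. Qed.

Lemma hom_comp_tgt (D1 D2 D3 : digraph) (p : Hom D1 D2) (q : Hom D2 D3) e :
  tgt ((homE q \o homE p) e) = (homV q \o homV p) (tgt e).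
Proof. by rewrite /= !hom_tgt. Qed.

Definition hom_comp (D1 D2 D3 : digraph) (p : Hom D1 D2) (q : Hom D2 D3) :
  Hom D1 D3 := MkHom (hom_comp_src p q) (hom_comp_tgt p q).

(* The digraph Z_[n,m], where the pair n, m is given as an interval I; the    *)
(* edge (i, i+1) is encoded by the integer i.                                 *)
Definition Zvert (I : interval int) : Type := {i : int | i \in I}.
Definition Zedge (I : interval int) : Type :=
  {i : int | (i \in I) && (i + 1 \in I)}.

Lemma Zsrc_subproof I (e : Zedge I) : val e \in I.
Proof. by case/andP: (valP e). Qed.

Lemma Ztgt_subproof I (e : Zedge I) : val e + 1 \in I.
Proof. by case/andP: (valP e). Qed.

Definition Zdig (I : interval int) : digraph :=
  @Digraph (Zvert I) (Zedge I)
    (fun e => exist _ (val e) (Zsrc_subproof e))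
    (fun e => exist _ (val e + 1) (Ztgt_subproof e)).

Notation walk I D := (Hom (Zdig I) D).
Notation biwalk D := (walk `]-oo, +oo[ D).

Definition biV (i : int) : Zvert `]-oo, +oo[ := exist _ i isT.
Definition biE (i : int) : Zedge `]-oo, +oo[ := exist _ i isT.

Lemma Zincl_src I (e : edge (Zdig I)) :
  @src (Zdig `]-oo, +oo[) (biE (val e)) = biV (val (src e)).
Proof. exact: val_inj. Qed.

Lemma Zincl_tgt I (e : edge (Zdig I)) :
  @tgt (Zdig `]-oo, +oo[) (biE (val e)) = biV (val (tgt e)).
Proof. exact: val_inj. Qed.

Definition Zincl (I : interval int) : walk I (Zdig `]-oo, +oo[) :=
  @MkHom (Zdig I) (Zdig `]-oo, +oo[) (fun i => biV (val i))
    (fun e => biE (val e)) (@Zincl_src I) (@Zincl_tgt I).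

Definition restr (D : digraph) (I : interval int) (h : biwalk D) : walk I D :=
  hom_comp (Zincl I) h.

Lemma shift_src (k : int) (e : edge (Zdig `]-oo, +oo[)) :
  @src (Zdig `]-oo, +oo[) (biE (val e + k)) = biV (val (src e) + k).
Proof. exact: val_inj. Qed.

Lemma shift_tgt (k : int) (e : edge (Zdig `]-oo, +oo[)) :
  @tgt (Zdig `]-oo, +oo[) (biE (val e + k)) = biV (val (tgt e) + k).
Proof. by apply: val_inj; rewrite /= addrAC. Qed.

(* the automorphism sigma^k of Z_[-oo,+oo] *)
Definition shift (k : int) : biwalk (Zdig `]-oo, +oo[) :=
  @MkHom (Zdig `]-oo, +oo[) (Zdig `]-oo, +oo[) (fun i => biV (val i + k))
    (fun e => biE (val e + k)) (shift_src k) (shift_tgt k).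

Definition UDAF (D : finDigraph) : Prop := forall v : fvert D,
  (~ exists! h : walk `[0, +oo[ D, homV h (exist _ 0 isT) = v) /\
  (~ exists! h : walk `]-oo, 0] D, homV h (exist _ 0 isT) = v).

Definition Adj (D : finDigraph) (v w : fvert D) : nat :=
  #|[set e : fedge D | (fsrc e == v) && (ftgt e == w)]%SET|.

Definition strongly_connected (D : finDigraph) : Prop :=
  forall v w : fvert D, connect [rel x y | (0 < Adj x y)%N] v w.

Definition in_coreV (D : finDigraph) (v : fvert D) : Prop :=
  exists (h : biwalk D) (i : int), homV h (biV i) = v.

Definition in_coreE (D : finDigraph) (e : fedge D) : Prop :=
  exists (h : biwalk D) (i : int), homE h (biE i) = e.

Definition coreV (D : finDigraph) : finType :=
  {v : fvert D | `[< in_coreV v >]}.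
Definition coreE (D : finDigraph) : finType :=
  {e : fedge D | `[< in_coreE e >]}.

Lemma core_src_subproof D (e : coreE D) : `[< in_coreV (fsrc (val e)) >].
Proof.
have /asboolP[h [i hi]] := valP e; apply/asboolP; exists h, i.
rewrite -hi; have /= -> := hom_src h (biE i).
by congr (homV h _); apply: val_inj.
Qed.

Lemma core_tgt_subproof D (e : coreE D) : `[< in_coreV (ftgt (val e)) >].
Proof.
have /asboolP[h [i hi]] := valP e; apply/asboolP; exists h, (i + 1).
rewrite -hi; have /= -> := hom_tgt h (biE i).
by congr (homV h _); apply: val_inj.
Qed.

Definition core (D : finDigraph) : finDigraph :=
  @FinDigraph (coreV D) (coreE D)
    (fun e => exist _ (fsrc (val e)) (core_src_subproof e))
    (fun e => exist _ (ftgt (val e)) (core_tgt_subproof e)).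

Definition rational (D : digraph) (w : walk `]-oo, 0] D) : Prop :=
  exists n m : int, [/\ n <= 0, m <= -1,
    (forall i j : Zvert `]-oo, 0],
       val i < n -> val j = val i + m -> homV w i = homV w j) &
    (forall i j : Zedge `]-oo, 0],
       val i < n -> val j = val i + m -> homE w i = homE w j)].

Definition irrational_past (D : digraph) (w : biwalk D) : Prop :=
  ~ rational (restr `]-oo, 0] w).

Definition shift_orbit (D : digraph) (h : biwalk D) : set (biwalk D) :=
  [set hom_comp (shift k) h | k in [set: int]].

Definition ray (D : digraph) (w : biwalk D) (n : int) : set (biwalk D) :=
  [set h | restr `]-oo, n] h = restr `]-oo, n] w].

Definition uray (D : digraph) (w : biwalk D) (n : int) :
  set (set (biwalk D)) := [set shift_orbit h | h in ray w n].

Definition is_uray (D : digraph) (R : set (set (biwalk D))) : Prop :=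
  exists (w : biwalk D) (n : int), irrational_past w /\ R = uray w n.

Definition central_vertex (D : digraph) (R : set (set (biwalk D)))
    (v : vert D) : Prop :=
  exists (w : biwalk D) (n : int),
    [/\ irrational_past w, R = uray w n & homV w (biV n) = v].

Definition is_ubeam (D : digraph) (B : set (set (biwalk D))) : Prop :=
  exists (k : nat) (R : 'I_k -> set (set (biwalk D))),
    (forall i, is_uray (R i)) /\ B = \bigcup_i R i.

Definition vertex_count (D : finDigraph) (B : set (set (biwalk D)))
    (M : {ffun fvert (core D) -> nat}) : Prop :=
  exists (k : nat) (R : 'I_k -> set (set (biwalk D)))
         (v : 'I_k -> fvert (core D)),
    [/\ forall i, is_uray (R i) /\ central_vertex (R i) (val (v i)),
        trivIset [set: 'I_k] R,
        B = \bigcup_i R i &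
        forall u, M u = #|[set i | v i == u]%SET|].

Definition common_beam (D : finDigraph)
    (M1 M2 : {ffun fvert (core D) -> nat}) : Prop :=
  exists B : set (set (biwalk D)),
    [/\ is_ubeam B, vertex_count B M1 & vertex_count B M2].

Definition sim (D : finDigraph) : {ffun fvert (core D) -> nat} ->
    {ffun fvert (core D) -> nat} -> Prop :=
  clos_refl_sym_trans _ (@common_beam D).

Definition MS (D : finDigraph) : Type :=
  {M : {ffun fvert (core D) -> nat} | M != 0}.

HB.instance Definition _ D := Choice.on (MS D).

Lemma MS_add_subproof D (M N : MS D) : val M + val N != 0.
Proof.
case: M N => M M0 [N _] /=; apply: contra_neq M0 => MN0.
apply/ffunP => v; have /ffunP/(_ v) := MN0; rewrite !ffunE => /eqP.
by rewrite addn_eq0 => /andP[/eqP].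
Qed.

Definition MS_add D (M N : MS D) : MS D :=
  exist _ (val M + val N) (MS_add_subproof M N).

Lemma MS_addC D : commutative (@MS_add D).
Proof. by move=> M N; apply: val_inj; rewrite /= addrC. Qed.

Lemma MS_addA D : associative (@MS_add D).
Proof. by move=> M N P; apply: val_inj; rewrite /= addrA. Qed.

HB.instance Definition _ D := Algebra.hasAdd.Build (MS D) (@MS_add D).
HB.instance Definition _ D :=
  Algebra.BaseAddMagma_isAddMagma.Build (MS D) (@MS_addC D).
HB.instance Definition _ D :=
  Algebra.AddMagma_isAddSemigroup.Build (MS D) (@MS_addA D).

Lemma indic_subproof D (v : fvert (core D)) :
  [ffun u => nat_of_bool (u == v)] != 0 :> {ffun fvert (core D) -> nat}.
Proof. by apply/eqP => /ffunP/(_ v); rewrite !ffunE eqxx. Qed.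

Definition indic D (v : fvert (core D)) : MS D :=
  exist _ [ffun u => nat_of_bool (u == v)] (indic_subproof v).

Definition MS_sim D : rel (MS D) := fun M N => `[< sim (val M) (val N) >].

Lemma MS_sim_refl D : reflexive (@MS_sim D).
Proof. by move=> M; apply/asboolP; apply: rst_refl. Qed.

Lemma MS_sim_sym D : symmetric (@MS_sim D).
Proof. by move=> M N; apply/asboolP/asboolP; apply: rst_sym. Qed.

Lemma MS_sim_trans D : transitive (@MS_sim D).
Proof.
by move=> N M P /asboolP MN /asboolP NP; apply/asboolP; apply: rst_trans NP.
Qed.

Canonical MS_sim_equiv D :=
  EquivRel (@MS_sim D) (@MS_sim_refl D) (@MS_sim_sym D) (@MS_sim_trans D).

Definition dim_semigroup (D : finDigraph) : Type := {eq_quot @MS_sim D}.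

Definition dim_class D (M : MS D) : dim_semigroup D :=
  \pi_({eq_quot @MS_sim D}) M.

(* [op] is the operation of the quotient semigroup MS(D)/~_D. It is unique if *)
(* it exists, and it exists exactly when ~_D is a congruence on MS(D).        *)
Definition quotient_add D (op : dim_semigroup D -> dim_semigroup D ->
    dim_semigroup D) : Prop :=
  forall M N : MS D, op (dim_class M) (dim_class N) = dim_class (M + N).

Definition is_abelian_group (T : Type) (op : T -> T -> T) : Prop :=
  exists (e : T) (inv : T -> T),
    [/\ associative op, commutative op, left_id e op & left_inverse e inv op].

Definition subgroup_gen (G : zmodType) (A : set G) : {pred G} :=
  fun x => `[< forall S : zmodClosed G, (forall a, A a -> a \in S) -> x \in S >].

Lemma subgroup_gen_closed (G : zmodType) (A : set G) :
  zmod_closed (subgroup_gen A).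
Proof.
split=> [|x y /asboolP xA /asboolP yA]; apply/asboolP => S AS.
  exact: rpred0.
by rewrite rpredB ?xA ?yA.
Qed.

HB.instance Definition _ (G : zmodType) (A : set G) :=
  GRing.isZmodClosed.Build G (subgroup_gen A) (subgroup_gen_closed A).

Definition free_gen (I : finType) (i : I) : {ffun I -> int} :=
  [ffun j => (j == i)%:R].

(* {ffun I -> int} is the free abelian group on I, with basis [free_gen]. *)
Definition ab_presentation (I : finType) (A : set {ffun I -> int}) : zmodType :=
  {ideal_quot (subgroup_gen A)}.

Definition ab_presentation_gen (I : finType) (A : set {ffun I -> int}) (i : I) :
  ab_presentation A := \pi_({ideal_quot (subgroup_gen A)}) (free_gen i).

Definition UDAF_relators (D : finDigraph) :
    set {ffun fvert (core D) -> int} :=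
  [set - free_gen v + \sum_(w : fvert (core D)) free_gen w *+ Adj v w
     | v in [set: fvert (core D)]].

(* Main.v *)
Require Import Defs.
From HB Require Import structures.
From Stdlib Require Import Relations.Relation_Operators.
From mathcomp Require Import all_boot all_order all_algebra.
From mathcomp Require Import all_classical zify.
Set Implicit Arguments.
Unset Strict Implicit.
Unset Printing Implicit Defensive.
Import Order.TTheory GRing.Theory Num.Theory.
Local Open Scope classical_set_scope.
Local Open Scope ring_scope.

(** Write [C] for the core of [D], [G] for the presented group, and send a
multiset [M] of vertices of [C] to its weight, the sum in [G] of the
generators of its elements. The theorem says that two nonzero multisets are
related by [sim] exactly when they have the same weight, and that every element
of [G] is the weight of a nonzero multiset.

Related multisets have equal weight ([sim_weight]). An irrational past is not
eventually equal to a proper shift of itself, so an orbit with irrational past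
contains exactly one walk eventually equal, towards minus infinity, to a fixed
representative of its tail-shift class. Passing to these walks turns unindexed
rays into cylinders, that is, into sets of walks with prescribed edges before
some time [n]. A finite disjoint union of cylinders is, at every late enough
time [L], a disjoint union of cylinders which all end at time [L], in only one
way, and passing from time [L] to time [L + 1] replaces an end vertex [v] by
the targets of the edges leaving [v], which leaves the weight unchanged because
of the relators. Hence the weight at late times depends only on the beam.

Multisets of equal weight are related ([weight_eqv], [eqv_sim]). Let an
out-split replace one occurrence of [v] by the targets of the edges leaving
[v]. On the multisets alone, strong connectivity and a vertex with two outgoing
edges allow any nonzero multiset to be transformed by out-splits into one that
exceeds any prescribed multiset by something nonzero ([reach_mset]). So the
nonzero multisets modulo out-splits form an abelian group, in which one may
cancel ([eqv_cancel]), and the relators of [G] hold there by construction. It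
remains to see that an out-split is an instance of [sim]. Splitting a ray
according to its next edge realizes an out-split inside a fixed beam, so it is
enough that every multiset is a vertex count of some beam ([realize]). By
[reach_mset] again, a single ray can be cut into pieces among which the
required central vertices occur, and the other pieces are thrown away. Thus one
irrational past is needed, and a diagonal argument against the countably many
eventually periodic ones provides it ([aperiodic_past]). *)

(** * Additive assignments on disjoint unions *)

(** Used twice: for weights of unions of cylinders and for vertex counts of
beams. *)
Section DisjointUnions.
Variables (T : Type) (V : nmodType) (P : set T -> V -> Prop).
Hypothesis P0 : P set0 0.
Hypothesis PU : forall X Y x y, (forall t, X t -> ~ Y t) ->
  P X x -> P Y y -> P (X `|` Y) (x + y).

Lemma additive_bigcup_seq (I : eqType) (r : seq I) (X : I -> set T) x :
  uniq r -> (forall i, i \in r -> P (X i) (x i)) ->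
  (forall i j t, i \in r -> j \in r -> X i t -> X j t -> i = j) ->
  P (\bigcup_(i in [set` r]) X i) (\sum_(i <- r) x i).
Proof.
elim: r => [_ _ _|i r IH /= /andP[ir ur] xP dX].
  rewrite big_nil (_ : bigcup _ _ = set0); first exact: P0.
  by apply/seteqP; split=> t // -[].
rewrite big_cons.
have -> : \bigcup_(j in [set` i :: r]) X j =
    X i `|` \bigcup_(j in [set` r]) X j.
  apply/seteqP; split=> t /=.
    move=> [j]; rewrite /= inE => /orP[/eqP -> |jr]; first by left.
    by move=> Xj; right; exists j.
  by move=> [Xi|[j jr Xj]]; [exists i|exists j];
    rewrite //= inE ?eqxx // jr orbT.
apply: PU; last 2 first.
- by apply: xP; rewrite inE eqxx.
- apply: IH => // [j jr|j j' t jr jr']; first by apply: xP; rewrite inE jr orbT.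
  by apply: dX; rewrite inE ?jr ?jr' orbT.
move=> t Xi [j /= jr Xj]; move/negP: ir; apply.
by rewrite (dX i j t) // inE ?eqxx // jr orbT.
Qed.

Lemma additive_bigcup_fin (I : finType) (p : pred I) (X : I -> set T) x :
  (forall i, p i -> P (X i) (x i)) ->
  (forall i j t, p i -> p j -> X i t -> X j t -> i = j) ->
  P (\bigcup_(i in [set i | p i]) X i) (\sum_(i | p i) x i).
Proof.
move=> xP dX; rewrite -big_filter.
have inr i : i \in [seq i <- index_enum I | p i] = p i.
  by rewrite mem_filter mem_index_enum andbT.
have -> : [set i | p i] = [set` [seq i <- index_enum I | p i]].
  by apply/seteqP; split=> i /=; rewrite inr.
apply: additive_bigcup_seq => [|i|i j t].
- by rewrite filter_uniq // index_enum_uniq.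
- by rewrite inr => /xP.
- by rewrite !inr; exact: dX.
Qed.

End DisjointUnions.

(** * Biwalks as sequences of edges *)

Section Biwalks.
Variable D : finDigraph.
Implicit Types (h w : biwalk D) (i j k n : int).

Definition bE h i : fedge D := homE h (biE i).
Definition bV h i : fvert D := homV h (biV i).

Lemma src_bE h i : fsrc (bE h i) = bV h i.
Proof.
by have /= -> := hom_src h (biE i); congr (homV h _); apply: val_inj.
Qed.

Lemma tgt_bE h i : ftgt (bE h i) = bV h (i + 1).
Proof.
by have /= -> := hom_tgt h (biE i); congr (homV h _); apply: val_inj.
Qed.

Lemma Hom_eq (D1 D2 : digraph) (p q : Defs.Hom D1 D2) :
  homV p =1 homV q -> homE p =1 homE q -> p = q.
Proof.
case: p q => [pV pE ps pt] [qV qE qs qt] /= /funext eV /funext eE.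
by subst qV qE; congr MkHom; apply: Prop_irrelevance.
Qed.

Lemma bE_inj h h' : bE h =1 bE h' -> h = h'.
Proof.
move=> eqE; apply: Hom_eq => [[i Pi]|[i Pi]].
  have -> : exist _ i Pi = biV i by apply: val_inj.
  by rewrite -/(bV h i) -/(bV h' i) -!src_bE eqE.
have -> : exist _ i Pi = biE i by apply: val_inj.
exact: eqE.
Qed.

Lemma biwalk_of (f : int -> fedge D) :
  (forall i, ftgt (f i) = fsrc (f (i + 1))) -> exists h, bE h =1 f.
Proof.
move=> fP.
have sP (e : edge (Zdig `]-oo, +oo[)) :
  @src D (f (val e)) = (fun x => fsrc (f (val x))) (src e) by [].
have tP (e : edge (Zdig `]-oo, +oo[)) :
  @tgt D (f (val e)) = (fun x => fsrc (f (val x))) (tgt e) by exact: fP.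
by exists (@MkHom (Zdig `]-oo, +oo[) D (fun x => fsrc (f (val x)))
                 (fun e => f (val e)) sP tP).
Qed.

Lemma bE_shift k h i : bE (hom_comp (shift k) h) i = bE h (i + k).
Proof. by []. Qed.

Lemma restr_eqP n h h' :
  restr `]-oo, n] h = restr `]-oo, n] h' <->
  (forall i, i < n -> bE h i = bE h' i).
Proof.
split=> [e i lt_in|eE].
  have Pi : (i \in `]-oo, n]) && (i + 1 \in `]-oo, n]).
    by rewrite !in_itv /=; lia.
  have := congr1 (fun g : walk `]-oo, n] D => homE g (exist _ i Pi)) e.
  by rewrite /= /bE.
apply: Hom_eq => [[i Pi]|[i Pi]] /=.
  rewrite -/(bV h i) -/(bV h' i).
  have -> : i = (i - 1) + 1 by lia.
  by rewrite -!tgt_bE eE //; move: Pi; rewrite in_itv /=; lia.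
rewrite -/(bE h i) -/(bE h' i) eE //.
by move: Pi; rewrite !in_itv /=; lia.
Qed.

Lemma restr_bV n h h' :
  restr `]-oo, n] h = restr `]-oo, n] h' -> bV h n = bV h' n.
Proof.
move=> /restr_eqP e; have -> : n = (n - 1) + 1 by lia.
by rewrite -!tgt_bE e //; lia.
Qed.

(** Splicing makes every core edge leaving the end of a past a possible
continuation of it. *)
Lemma glue w n h i : bV w n = bV h i ->
  exists g, (forall j, j < n -> bE g j = bE w j) /\
            (forall j, n <= j -> bE g j = bE h (j - n + i)).
Proof.
move=> e.
have [j|g gP] :=
  @biwalk_of (fun j => if j < n then bE w j else bE h (j - n + i)).
  case: ltP => ?; case: ltP => ?; rewrite tgt_bE src_bE //.
  - have -> : j + 1 = n by lia.
    by rewrite e; congr bV; lia.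
  - lia.
  - by congr bV; lia.
exists g; split=> j jn; rewrite gP; first by rewrite jn.
by rewrite ltNge jn.
Qed.

(** Irrationality only says that no past is repeated under a negative shift, but
a positive period is a negative one read backwards. *)
Lemma irrational_past_shift w : irrational_past w ->
  forall n k, (forall i, i < n -> bE w (i + k) = bE w i) -> k = 0.
Proof.
move=> irr n k wk; apply: contrapT => /eqP k0; apply: irr.
suff [n' [m [n'0 m1 P]]] : exists n' m, [/\ n' <= 0, m <= -1 &
    forall i, i < n' -> bE w i = bE w (i + m)].
  exists n', m; split=> // i j lt_in ej /=.
    by rewrite ej -/(bV w _) -/(bV w (val i + m)) -!src_bE P.
  by rewrite ej; exact: P.
exists (Num.min 0 (n - `|k|)), (- `|k|); split; [lia|lia|] => i ni.
have [k_gt0|k_le0] := ltP 0 k.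
  by rewrite -(wk (i + - `|k|)); [congr bE; lia|lia].
by rewrite -(wk i); [congr bE; lia|lia].
Qed.

Lemma irrational_pastP w :
  (forall n k, (forall i, i < n -> bE w (i + k) = bE w i) -> k = 0) ->
  irrational_past w.
Proof.
move=> P [n [m [n0 m1 _ mE]]].
suff : m = 0 by lia.
apply: (P (n - 1)) => i lt_in.
have Pi : (i \in `]-oo, 0]) && (i + 1 \in `]-oo, 0]) by rewrite !in_itv /=; lia.
have Pj : (i + m \in `]-oo, 0]) && (i + m + 1 \in `]-oo, 0]).
  by rewrite !in_itv /=; lia.
have /= := mE (exist _ i Pi) (exist _ (i + m) Pj).
by rewrite /bE => -> //; lia.
Qed.

Lemma irrational_past_tail w h s n : irrational_past w ->
  (forall i, i < n -> bE h i = bE w (i + s)) -> irrational_past h.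
Proof.
move=> irr e; apply: irrational_pastP => m k P.
apply: (irrational_past_shift irr (n := Num.min m n - `|k| + s)) => i lt_i.
have -> : i = (i - s) + s by lia.
rewrite -e; last lia.
have -> : i - s + s + k = i - s + k + s by lia.
by rewrite -e ?P //; lia.
Qed.

Lemma rayP w n h : ray w n h <-> (forall i, i < n -> bE h i = bE w i).
Proof. exact: restr_eqP. Qed.

Lemma shift_orbitP h g :
  shift_orbit h g <-> exists k, forall i, bE g i = bE h (i + k).
Proof.
split=> [[k _ <-]|[k e]]; first by exists k.
by exists k => //; apply: bE_inj => i; rewrite bE_shift e.
Qed.

Lemma shift_orbit_eq h g k : (forall i, bE g i = bE h (i + k)) ->
  shift_orbit g = shift_orbit h.
Proof.
move=> e; apply/seteqP; split=> x /shift_orbitP[m xP]; apply/shift_orbitP.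
  by exists (m + k) => i; rewrite xP e addrA.
by exists (m - k) => i; rewrite xP e; congr bE; lia.
Qed.

Lemma shift_orbit_refl h : shift_orbit h h.
Proof. by apply/shift_orbitP; exists 0 => i; rewrite addr0. Qed.

Lemma uray_shift w n k : uray (hom_comp (shift k) w) n = uray w (n + k).
Proof.
apply/seteqP; split=> _ [h /rayP hP <-].
  exists (hom_comp (shift (- k)) h).
    by apply/rayP => i ni; rewrite bE_shift hP ?bE_shift; [congr bE|]; lia.
  by apply: (@shift_orbit_eq _ _ (- k)) => i.
exists (hom_comp (shift k) h).
  by apply/rayP => i ni; rewrite !bE_shift hP //; lia.
by apply: (@shift_orbit_eq _ _ k) => i.
Qed.

(** Two walks of a ray in the same orbit would give the irrational past of the ray
a period. This is why disjoint cylinders in one ray give disjoint unindexed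
rays. *)
Lemma shift_orbit_inj_ray w n h g :
  irrational_past w -> ray w n h -> ray w n g ->
  shift_orbit h = shift_orbit g -> h = g.
Proof.
move=> irr /rayP hP /rayP gP e.
have /shift_orbitP[k kP] : shift_orbit g h.
  by rewrite -e; exact: shift_orbit_refl.
have k0 : k = 0.
  apply: (irrational_past_shift irr (n := n - `|k|)) => i lt_i.
  by rewrite -(hP i) ?kP ?gP //; lia.
by apply: bE_inj => i; rewrite kP k0 addr0.
Qed.

Lemma bV_core h i : `[< in_coreV (bV h i) >].
Proof. by apply/asboolP; exists h, i. Qed.

Definition cV h i : fvert (core D) := exist _ (bV h i) (bV_core h i).

Lemma bE_core h i : `[< in_coreE (bE h i) >].
Proof. by apply/asboolP; exists h, i. Qed.

Definition cE h i : fedge (core D) := exist _ (bE h i) (bE_core h i).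

Lemma src_cE h i : fsrc (cE h i) = cV h i.
Proof. by apply: val_inj; rewrite /= src_bE. Qed.

Lemma tgt_cE h i : ftgt (cE h i) = cV h (i + 1).
Proof. by apply: val_inj; rewrite /= tgt_bE. Qed.

(** The edge lies in the core, so some biwalk through it supplies the future. *)
Lemma extend w n (e : fedge (core D)) : fsrc e = cV w n ->
  exists g, ray w n g /\ cE g n = e.
Proof.
move=> se; have /asboolP[h [i hi]] := valP e.
have [|g [gw gh]] := @glue w n h i.
  by have /(congr1 val) /= <- := se; rewrite -hi src_bE.
exists g; split; first exact/rayP.
by apply: val_inj; rewrite /= gh // subrr add0r.
Qed.

(** Total by convention: the value [w] is a dummy when [e] does not start at the
vertex reached by [w] at time [n]. *)
Definition ext w n (e : fedge (core D)) : biwalk D :=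
  if pselect (fsrc e = cV w n) is left se then projT1 (cid (extend se)) else w.

Lemma extP w n e :
  fsrc e = cV w n -> ray w n (ext w n e) /\ cE (ext w n e) n = e.
Proof.
by rewrite /ext; case: pselect => // se _; case: cid.
Qed.

Lemma ext_irr w n e : fsrc e = cV w n -> irrational_past w ->
  irrational_past (ext w n e).
Proof.
move=> /extP[/rayP eP _] irr; apply: (irrational_past_tail (s := 0) irr) => i.
by rewrite addr0; exact: eP.
Qed.

Lemma ext_tgt w n e : fsrc e = cV w n -> cV (ext w n e) (n + 1) = ftgt e.
Proof. by move=> /extP[_ en]; rewrite -[in RHS]en tgt_cE. Qed.

Lemma ray_ext w n e h : fsrc e = cV w n ->
  ray (ext w n e) (n + 1) h <-> ray w n h /\ cE h n = e.
Proof.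
move=> /extP[/rayP eP en]; split=> [/rayP hP|[/rayP hP hn]].
  split; first by apply/rayP=> i ni; rewrite hP ?eP //; lia.
  by rewrite -en; apply: val_inj; rewrite /= hP //; lia.
apply/rayP => i lt_i; have [->|ni] := eqVneq i n.
  by have /(congr1 val) /= -> := hn; have /(congr1 val) /= -> := en.
by rewrite eP ?hP //; lia.
Qed.

Lemma ray_split w n :
  ray w n = \bigcup_(e in [set e | fsrc e == cV w n]) ray (ext w n e) (n + 1).
Proof.
apply/seteqP; split=> h.
  move=> hw; have se : fsrc (cE h n) = cV w n.
    by apply: val_inj; rewrite src_cE /=; exact: restr_bV.
  by exists (cE h n); [exact/eqP|exact/ray_ext].
by move=> [e /= /eqP se /(ray_ext _ se)[]].
Qed.

End Biwalks.

(** * Tails of biwalks *)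

Section Tails.
Variable D : finDigraph.
Implicit Types h : biwalk D.

Definition tail_eq h h' := exists n, forall i, i < n -> bE h i = bE h' i.
Definition tail_shift h h' := exists s n,
  forall i, i < n -> bE h' i = bE h (i + s).

Lemma tail_eq_sym h h' : tail_eq h h' -> tail_eq h' h.
Proof. by move=> [n nP]; exists n => i /nP. Qed.

Lemma tail_eq_trans h h' h'' : tail_eq h h' -> tail_eq h' h'' -> tail_eq h h''.
Proof.
move=> [n nP] [m mP]; exists (Num.min n m) => i; rewrite lt_min => /andP[? ?].
by rewrite nP // mP.
Qed.

Lemma tail_eq_shift h h' : tail_eq h h' -> tail_shift h h'.
Proof. by move=> [n nP]; exists 0, n => i /nP; rewrite addr0. Qed.

Lemma tail_shift_sym h h' : tail_shift h h' -> tail_shift h' h.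
Proof.
move=> [s [n nP]]; exists (- s), (n + s) => i lt_i.
by rewrite nP; [congr bE|]; lia.
Qed.

Lemma tail_shift_trans h h' h'' :
  tail_shift h h' -> tail_shift h' h'' -> tail_shift h h''.
Proof.
move=> [s [n nP]] [t [m mP]]; exists (t + s), (Num.min m (n - t)) => i.
rewrite lt_min => /andP[? ?].
by rewrite mP // nP ?addrA //; lia.
Qed.

(** The representative is chosen from the class, seen as a predicate, and is
therefore the same for all its members. *)
Lemma tail_representative : exists c : biwalk D -> biwalk D,
  (forall h, tail_shift h (c h)) /\
  (forall h h', tail_shift h h' -> c h = c h').
Proof.
have ex h : exists h', tail_shift h h' by exists h, 0, 0 => i _; rewrite addr0.
exists (fun h => sval (cid (ex h))); split=> [h|h h' hh'].
  exact: (svalP (cid (ex h))).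
have eq_class : tail_shift h = tail_shift h'.
  apply/funext => x; apply/propext; split; apply: tail_shift_trans => //.
  exact: tail_shift_sym.
(* equal classes, and proof irrelevance, give equal choices *)
move: (ex h) (ex h'); rewrite eq_class => p q.
by rewrite (Prop_irrelevance p q).
Qed.

End Tails.

(** * Related multisets have equal weight *)

Section Weight.
Variables (D : finDigraph) (G : nmodType) (gen : fvert (core D) -> G).
Hypothesis gen_split : forall v,
  gen v = \sum_(e : fedge (core D) | fsrc e == v) gen (ftgt e).
Implicit Types (h w : biwalk D) (n L : int) (X Y : set (biwalk D)).

(** The past of [h] before [L] names a cylinder ending at time [L]. The vertex
reached is recorded as a vertex of the core, where generators live. *)
Definition key L h : {classic walk `]-oo, L] D} * fvert (core D) :=
  (restr `]-oo, L] h, cV h L).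

Lemma keyP L h h' : key L h = key L h' <-> ray h' L h.
Proof.
split=> [/(congr1 fst) //|e]; rewrite /key.
have -> : cV h L = cV h' L by apply: val_inj; exact: restr_bV.
by move: e; rewrite /ray /= => ->.
Qed.

(** The list [ks] names cylinders ending at time [L] whose disjoint union is [X];
the second condition excludes names of empty cylinders. *)
Definition weighs L X g := exists ks : seq ({classic walk `]-oo, L] D} * _),
  [/\ uniq ks, (forall k, k \in ks -> exists h, key L h = k),
      (forall h, X h <-> key L h \in ks) & \sum_(k <- ks) gen k.2 = g].

(** The cylinders are determined by [X]: they are the pasts before [L] of its
elements. *)
Lemma weighs_uniq L X g g' : weighs L X g -> weighs L X g' -> g = g'.
Proof.
move=> [ks [u r m <-]] [ks' [u' r' m' <-]]; apply: perm_big.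
apply: uniq_perm => // k; apply/idP/idP => kin.
  by have [h hk] := r _ kin; rewrite -hk; apply/m'/m; rewrite hk.
by have [h hk] := r' _ kin; rewrite -hk; apply/m/m'; rewrite hk.
Qed.

Lemma weighs_ray w n : weighs n (ray w n) (gen (cV w n)).
Proof.
exists [:: key n w]; split=> //.
- by move=> k; rewrite inE => /eqP ->; exists w.
- by move=> h; rewrite inE; split=> [/keyP/eqP //|/eqP/keyP].
- by rewrite big_seq1.
Qed.

Lemma weighsU L X Y g g' : (forall h, X h -> ~ Y h) ->
  weighs L X g -> weighs L Y g' -> weighs L (X `|` Y) (g + g').
Proof.
move=> XY [ks [u r m <-]] [ks' [u' r' m' <-]].
exists (ks ++ ks'); split.
- rewrite cat_uniq u u' /= andbT; apply/hasPn => k kin'; apply/negP => /= kin.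
  by have [h hk] := r _ kin; apply: (XY h); [apply/m|apply/m']; rewrite hk.
- by move=> k; rewrite mem_cat => /orP[/r|/r'].
- by move=> h; rewrite mem_cat; split=> [[/m ->|/m' ->]|/orP[/m|/m']];
    rewrite ?orbT //; [left|right].
- by rewrite big_cat.
Qed.

Lemma weighs0 L : weighs L set0 0.
Proof. by exists [::]; split; rewrite ?big_nil. Qed.

(** The cylinder is cut according to its next edge, and the relation between the
generators keeps the weight. *)
Lemma weighs_ray_succ w n : weighs (n + 1) (ray w n) (gen (cV w n)).
Proof.
rewrite ray_split gen_split.
apply: (additive_bigcup_fin (weighs0 _) (@weighsU _)).
- by move=> e /eqP se; rewrite -(ext_tgt se); exact: weighs_ray.
- by move=> e e' h /eqP se /eqP se' /(ray_ext _ se)[_ <-] /(ray_ext _ se')[].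
Qed.

Lemma weighs_succ L X g : weighs L X g -> weighs (L + 1) X g.
Proof.
move=> [ks [u r m <-]].
have -> : X = \bigcup_(k in [set` ks]) [set h | key L h = k].
  apply/seteqP; split=> h; first by move=> /m kh; exists (key L h).
  by move=> [k /= ? hk]; apply/m; rewrite hk.
apply: (additive_bigcup_seq (weighs0 _) (@weighsU _) u);
  last by move=> k k' h _ _ <-.
move=> k /r[w kw].
have -> : [set h | key L h = k] = ray w L.
  by apply/seteqP; split=> h; rewrite /= -kw => /keyP.
by rewrite -kw; exact: weighs_ray_succ.
Qed.

Lemma weighs_le L L' X g : L <= L' -> weighs L X g -> weighs L' X g.
Proof.
move=> LL'; have -> : L' = L + `|L' - L|%N by lia.
elim: `|_|%N => [|d IH]; first by rewrite addr0.
by move=> /IH/weighs_succ; rewrite -addrA -PoszD addn1.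
Qed.

(** The walks in [slice B] are those, one in each orbit of [B] with irrational
past, that are eventually equal to the representative of their class. The
point is that [slice] depends on [B] only, while the weight is computed from
an arbitrary vertex count. *)
Lemma beam_weight : exists slice : set (set (biwalk D)) -> set (biwalk D),
  forall B (M : {ffun fvert (core D) -> nat}), vertex_count B M ->
  exists L0, forall L, L0 <= L -> weighs L (slice B) (\sum_u gen u *+ M u).
Proof.
have [c [cP c_eq]] := tail_representative D.
pose slice (B : set (set (biwalk D))) :=
  [set h | [/\ irrational_past h, tail_eq h (c h) & B (shift_orbit h)]].
exists slice.
(* a ray whose past is already normalized becomes a cylinder *)
have slice_uray w n : irrational_past w -> tail_eq w (c w) ->
  slice (uray w n) = ray w n.
  move=> irr wc; apply/seteqP; split=> h; last first.
    move=> hw; have tw : tail_eq h w by exists n; exact/rayP.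
    split; last by exists h.
      apply: (irrational_past_tail (s := 0) (n := n) irr) => i.
      by rewrite addr0; move: i; exact/rayP.
    by rewrite (c_eq _ _ (tail_eq_shift tw)); exact: tail_eq_trans wc.
  move=> [irrh hc [g gw eo]].
  have tg : tail_eq g w by exists n; exact/rayP.
  have /shift_orbitP[k hk] : shift_orbit g h.
    by rewrite eo; exact: shift_orbit_refl.
  have gh : tail_shift g h by exists k, 0 => i _.
  have ch : c h = c w by rewrite -(c_eq _ _ gh); exact/c_eq/tail_eq_shift.
  have [m mP] : tail_eq h g.
    apply: tail_eq_trans hc _; rewrite ch.
    by apply: tail_eq_trans (tail_eq_sym tg); exact: tail_eq_sym.
  have k0 : - k = 0.
    apply: (irrational_past_shift irrh (n := Num.min m (m + k))) => i.
    by rewrite lt_min => /andP[? ?]; rewrite hk mP //; congr bE; lia.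
  suff -> : h = g by [].
  by apply: bE_inj => i; rewrite hk; congr bE; lia.
move=> B M [k [R [v [Rv triv -> Mv]]]].
have /choice[n nP] i : exists n, forall L, n <= L ->
    weighs L (slice (R i)) (gen (v i)).
  have [_ [w [n [irr -> wv]]]] := Rv i.
  (* shifting by [s] normalizes the past, and moves the centre to [n - s] *)
  have [s [m mP]] := cP w.
  have sE : uray w n = uray (hom_comp (shift s) w) (n - s).
    by rewrite uray_shift; congr uray; lia.
  exists (n - s) => L nL; rewrite sE slice_uray.
  - have -> : v i = cV (hom_comp (shift s) w) (n - s).
      by apply: val_inj; rewrite -wv; congr (homV w (biV _)) => /=; lia.
    by apply: weighs_le nL _; exact: weighs_ray.
  - by apply: (irrational_past_tail (s := s) (n := 0) irr) => j _.
  - suff <- : c w = c (hom_comp (shift s) w) by exists m => j /mP ->.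
    by apply: c_eq; exists s, 0 => j _.
exists (\sum_i `|n i|) => L nL.
have -> : slice (\bigcup_i R i) = \bigcup_(i in [set i | xpredT i]) slice (R i).
  apply/seteqP; split=> h.
    by move=> [irr hc [i _ Ri]]; exists i.
  by move=> [i _ [irr hc Ri]]; split=> //; exists i.
have -> : \sum_u gen u *+ M u = \sum_i gen (v i).
  rewrite (partition_big v xpredT) //=; apply: eq_bigr => u _.
  rewrite Mv -sum1_card -sumrMnr; apply: eq_big => [i|i]; rewrite inE //.
  by move=> /eqP ->.
apply: (additive_bigcup_fin (weighs0 _) (@weighsU _)) =>
  [i _|i j h _ _ [_ _ Ri] [_ _ Rj]].
- apply: nP; apply: le_trans nL; rewrite (bigD1 i) //=.
  by apply: le_trans (ler_norm _) _; rewrite lerDl sumr_ge0.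
- by apply: (triv i j) => //; exists (shift_orbit h).
Qed.

Lemma sim_weight (M N : {ffun fvert (core D) -> nat}) : sim M N ->
  \sum_u gen u *+ M u = \sum_u gen u *+ N u.
Proof.
elim=> {M N} [M N [B [_ BM BN]]|//|M N _ -> //|M N P _ -> _ -> //].
have [slice sP] := beam_weight.
have [L LP] := sP _ _ BM; have [L' LP'] := sP _ _ BN.
apply: weighs_uniq (LP (Num.max L L') _) (LP' (Num.max L L') _).
  by rewrite le_max lexx.
by rewrite le_max lexx orbT.
Qed.

End Weight.

(** * Out-splits of multisets of vertices *)

Section Splitting.
Variable C : finDigraph.
Notation mset := {ffun fvert C -> nat}.
Implicit Types (v w : fvert C) (M N X Y : mset).

Definition single v : mset := [ffun u => nat_of_bool (u == v)].
Definition out_mset v : mset :=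
  \sum_(e : fedge C | fsrc e == v) single (ftgt e).
Definition out_split M M' :=
  exists N v, M = N + single v /\ M' = N + out_mset v.
Definition reach := clos_refl_trans _ out_split.
Definition eqv := clos_refl_sym_trans _ out_split.

Lemma mset_add_neq0r M N : N != 0 -> M + N != 0.
Proof.
apply: contra_neq => /ffunP e; apply/ffunP => v; have := e v; rewrite !ffunE.
by move=> /eqP; rewrite addn_eq0 => /andP[_ /eqP].
Qed.

Lemma single_neq0 v : single v != 0.
Proof. by apply/eqP => /ffunP/(_ v); rewrite !ffunE eqxx. Qed.

Lemma mset_ind (P : mset -> Prop) :
  P 0 -> (forall M v, P M -> P (M + single v)) -> forall M, P M.
Proof.
move=> P0 PS M; move: {2}(\sum_v M v)%N (erefl (\sum_v M v)%N) => k.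
elim: k M => [|k IH] M.
  move/eqP; rewrite sum_nat_eq0 => /forallP M0.
  by have -> : M = 0 by apply/ffunP => v; rewrite ffunE; have /eqP := M0 v.
move=> sM; have [v v0] : exists v, (0 < M v)%N.
  apply/existsP; apply: contra_eqT sM; rewrite negb_exists => /forallP M0.
  by rewrite big1 // => v _; apply/eqP; rewrite -leqn0 leqNgt.
pose N : mset := [ffun u => M u - (u == v)]%N.
have MN : M = N + single v.
  by apply/ffunP => u; rewrite !ffunE; case: eqP => [->|_] /=; lia.
rewrite MN; apply/PS/IH/succn_inj; rewrite -sM [in RHS]MN -addn1.
under [RHS]eq_bigr do rewrite ffunE.
rewrite big_split /=; congr (_ + _)%N.
rewrite (bigD1 v) //= big1 ?ffunE ?eqxx // => u.
by rewrite ffunE => /negPf ->.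
Qed.

Lemma mset_neq0P M : M != 0 -> exists N v, M = N + single v.
Proof. by elim/mset_ind: M => [|M v _ _]; [rewrite eqxx|exists M, v]. Qed.

Lemma reach_eqv M N : reach M N -> eqv M N.
Proof. by elim=> [???|?|??? _ H _ H'];
  [exact: rst_step|exact: rst_refl|exact: rst_trans H H']. Qed.

Lemma reachD M M' N N' : reach M M' -> reach N N' -> reach (M + N) (M' + N').
Proof.
have R K L X : reach K L -> reach (K + X) (L + X).
  elim=> {K L} [K L [Y [v [-> ->]]]|?|??? _ H _ H'];
    [|exact: rt_refl|exact: rt_trans H H'].
  by apply: rt_step; exists (Y + X), v; rewrite -!addrA ![X + _]addrC.
move=> r r'; apply: rt_trans (R _ _ _ r) _.
by rewrite ![M' + _]addrC; exact: R.
Qed.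

Lemma eqvD M M' N N' : eqv M M' -> eqv N N' -> eqv (M + N) (M' + N').
Proof.
have R K L X : eqv K L -> eqv (K + X) (L + X).
  elim=> {K L} [K L [Y [v [-> ->]]]|?|?? _ H|??? _ H _ H'];
    [|exact: rst_refl|exact: rst_sym|exact: rst_trans H H'].
  by apply: rst_step; exists (Y + X), v; rewrite -!addrA ![X + _]addrC.
move=> r r'; apply: rst_trans (R _ _ _ r) _.
by rewrite ![M' + _]addrC; exact: R.
Qed.

Lemma reach_out v : reach (single v) (out_mset v).
Proof. by apply: rt_step; exists 0, v; rewrite !add0r. Qed.

Hypothesis conn : strongly_connected C.
Variables e1 e2 : fedge C.
Hypotheses (e12 : e1 != e2) (src12 : fsrc e1 = fsrc e2).

Lemma reach_vertex v w : exists X, reach (single v) (single w + X).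
Proof.
have /connectP[p] := conn v w; elim: p v => [|x p IH] v /=.
  by move=> _ ->; exists 0; rewrite addr0; exact: rt_refl.
move=> /andP[/card_gt0P[e]]; rewrite inE => /andP[se /eqP te] pp wl.
have [X rX] := IH x pp wl.
exists (X + \sum_(e' | (fsrc e' == v) && (e' != e)) single (ftgt e')).
apply: rt_trans (reach_out v) _.
by rewrite /out_mset (bigD1 e) //= te addrA; apply: reachD rX _; exact: rt_refl.
Qed.

(** A detour through the branching vertex leaves the second edge over, so the
surplus is nonzero. *)
Lemma reach_branching v w : exists2 X, X != 0 & reach (single v) (single w + X).
Proof.
have [X rX] := reach_vertex v (fsrc e1).
have [Y rY] := reach_vertex (ftgt e1) w.
set Z := \sum_(e | (fsrc e == fsrc e1) && (e != e1) && (e != e2))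
  single (ftgt e).
exists (Y + Z + X + single (ftgt e2)).
  by rewrite mset_add_neq0r // single_neq0.
apply: rt_trans rX _.
have -> : single w + (Y + Z + X + single (ftgt e2)) =
  (single w + Y) + (single (ftgt e2) + Z) + X.
  by rewrite !addrA -!addrA; congr (_ + (_ + _)); rewrite [RHS]addrC addrA.
apply: reachD (rt_refl _ _ _).
apply: rt_trans (reach_out _) _.
rewrite /out_mset (bigD1 e1) //= (bigD1 e2) /=; last first.
  by rewrite src12 eqxx eq_sym.
by apply: reachD rY (rt_refl _ _ _).
Qed.

(** Each further vertex is produced from an element of the surplus, which is why
the surplus is kept nonzero. *)
Lemma reach_vertex_mset v M : exists2 X, X != 0 & reach (single v) (M + X).
Proof.
elim/mset_ind: M => [|M w [X X0 rX]].
  by exists (single v); rewrite ?single_neq0 // add0r; exact: rt_refl.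
have [Y [u eX]] := mset_neq0P X0; subst X.
have [Z Z0 rZ] := reach_branching u w.
exists (Y + Z); first exact: mset_add_neq0r.
apply: rt_trans rX _; rewrite addrA.
have -> : M + single w + (Y + Z) = M + Y + (single w + Z).
  by rewrite -!addrA; congr (_ + _); rewrite addrCA.
by apply: reachD rZ; exact: rt_refl.
Qed.

Lemma reach_mset M N : M != 0 -> exists2 X, X != 0 & reach M (N + X).
Proof.
move=> /mset_neq0P[Y [v ->]]; have [X X0 rX] := reach_vertex_mset v N.
exists (Y + X); first exact: mset_add_neq0r.
by rewrite addrCA; apply: reachD rX; exact: rt_refl.
Qed.

(** If [v] is equivalent to [v + I] then adding [I] changes no class, since
every nonzero multiset is equivalent to one that contains [v]. *)
Lemma eqv_neutral v : exists2 I, I != 0 & forall K, K != 0 -> eqv K (K + I).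
Proof.
have [I I0 /reach_eqv eI] := reach_mset (single v) (single_neq0 v).
exists I => // K /(reach_mset (single v))[Y _ /reach_eqv eY].
apply: (rst_trans _ _ _ _ _ eY); apply: rst_sym.
apply: rst_trans (eqvD eY (rst_refl _ _ I)) _; rewrite addrAC.
by apply: eqvD (rst_refl _ _ _); exact: rst_sym.
Qed.

(** The neutral multiset is equivalent to some [X + Y], so that adding [Y]
undoes the addition of [X]. *)
Lemma eqv_cancel M N X : M != 0 -> N != 0 -> eqv (M + X) (N + X) -> eqv M N.
Proof.
move=> M0 N0 e; have [_ [v _]] := mset_neq0P M0.
have [I I0 neutral] := eqv_neutral v.
have [Y _ /reach_eqv eY] := reach_mset X I0.
apply: rst_trans (neutral M M0) _.
apply: rst_trans (eqvD (rst_refl _ _ M) eY) _; rewrite addrA.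
apply: rst_trans (eqvD e (rst_refl _ _ Y)) _; rewrite -addrA.
apply: rst_trans (eqvD (rst_refl _ _ N) (rst_sym _ _ _ _ eY)) _.
exact/rst_sym/neutral.
Qed.

End Splitting.

(** * Vertex counts of beams *)

Section VertexCount.
Variable D : finDigraph.
Implicit Types (B : set (set (biwalk D))) (w : biwalk D) (n : int).
Notation mset := {ffun fvert (core D) -> nat}.

Lemma vertex_count_fin (I : finType) (R : I -> set (set (biwalk D)))
    (v : I -> fvert (core D)) B (M : mset) :
  (forall i, is_uray (R i) /\ central_vertex (R i) (val (v i))) ->
  (forall i j x, R i x -> R j x -> i = j) -> B = \bigcup_i R i ->
  (forall u, M u = #|[set i | v i == u]%SET|) -> vertex_count B M.
Proof.
move=> Rv dR -> Mv.
exists #|I|, (fun i => R (enum_val i)), (fun i => v (enum_val i)); split=> //.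
- by move=> i j _ _ [x [/= Ri Rj]]; apply: enum_val_inj; exact: dR Ri Rj.
- apply/seteqP; split=> x [i _ Ri]; last by exists (enum_val i).
  by exists (enum_rank i) => //=; rewrite enum_rankK.
move=> u; rewrite Mv -(card_imset _ enum_val_inj); apply: eq_card => i.
apply/idP/imsetP; rewrite inE; last by move=> [j]; rewrite inE => /eqP <- ->.
by move=> /eqP <-; exists (enum_rank i); rewrite ?inE enum_rankK.
Qed.

Lemma vertex_count0 : @vertex_count D set0 0.
Proof.
apply: (@vertex_count_fin void (fun=> set0) (fun i => match i with end)) => //.
- by apply/seteqP; split=> x // [].
- move=> u; rewrite ffunE; apply/esym/eqP.
  by rewrite cards_eq0; apply/eqP/setP; case.
Qed.

Lemma vertex_count_uray (R : set (set (biwalk D))) (v : fvert (core D)) :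
  is_uray R -> central_vertex R (val v) -> vertex_count R (single v).
Proof.
move=> uR cR; apply: (@vertex_count_fin unit (fun=> R) (fun=> v)) => //.
- by move=> [] [].
- by apply/seteqP; split=> x; [exists tt|case].
move=> u; rewrite ffunE; case: (eqVneq v u) => _ /=; apply/esym/eqP.
  rewrite (_ : [set _ | _]%SET = [set tt]%SET) ?cards1 //.
  by apply/setP => -[]; rewrite !inE.
by rewrite cards_eq0; apply/eqP/setP => i; rewrite !inE.
Qed.

Lemma vertex_countU B B' (M M' : mset) : (forall x, B x -> ~ B' x) ->
  vertex_count B M -> vertex_count B' M' -> vertex_count (B `|` B') (M + M').
Proof.
move=> BB' [k [R [v [Rv tR eB Mv]]]] [k' [R' [v' [Rv' tR' eB' Mv']]]].
pose cs X (f : 'I_k -> X) (f' : 'I_k' -> X) i :=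
  match i with inl j => f j | inr j => f' j end.
apply: (@vertex_count_fin _ (cs _ R R') (cs _ v v')).
- by case.
- move=> [i|i] [j|j] x /= Ri Rj.
  + by congr inl; apply: tR => //; exists x.
  + by have [] := BB' x; rewrite ?eB ?eB'; [exists i|exists j].
  + by have [] := BB' x; rewrite ?eB ?eB'; [exists j|exists i].
  + by congr inr; apply: tR' => //; exists x.
- rewrite eB eB'; apply/seteqP; split=> x.
    by move=> [[i _ Ri]|[i _ Ri]]; [exists (inl i)|exists (inr i)].
  by move=> [[i|i] _ Ri]; [left|right]; exists i.
move=> u; rewrite ffunE Mv Mv' -!sum1_card big_sumType /=.
by congr (_ + _)%N; apply: eq_bigl => i; rewrite !inE.
Qed.

Lemma vertex_count_extract B (M : mset) v : vertex_count B (M + single v) ->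
  exists R B' : set (set (biwalk D)),
  [/\ central_vertex R (val v), (forall x, R x -> ~ B' x), B = R `|` B' &
      vertex_count B' M].
Proof.
move=> [k [R [c [Rc tR eB Mc]]]].
have [i0 ci0] : exists i, c i = v.
  have : (0 < (M + single v)%R v)%N by rewrite !ffunE eqxx; exact: ltn_addl.
  by rewrite Mc => /card_gt0P[i]; rewrite inE => /eqP; exists i.
exists (R i0), (\bigcup_(i : {i | i != i0}) R (val i)); split.
- by rewrite -ci0; case: (Rc i0).
- move=> x R0 [[i ii0] _ /= Ri]; move/eqP: ii0; apply.
  by apply: tR => //; exists x.
- rewrite eB; apply/seteqP; split=> x; last first.
    by move=> [|[i _]]; [exists i0|exists (val i)].
  move=> [i _ Ri]; have [<-|ii0] := eqVneq i i0; first by left.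
  by right; exists (exist _ i ii0).
apply: (@vertex_count_fin _ _ (fun i : {i | i != i0} => c (val i))) =>
  [i||//|u].
- exact: Rc.
- by move=> i j x Ri Rj; apply/val_inj/tR => //; exists x.
have /addnI -> :
    ((u == v) + M u = (u == v) + #|[set i | c i == u] :\ i0|%SET)%N.
  have := Mc u; rewrite !ffunE (cardsD1 i0) inE ci0 [v == u]eq_sym => <-.
  exact: addnC.
rewrite -(card_imset _ val_inj); apply: eq_card => i.
apply/idP/imsetP; rewrite !inE.
  by move=> /andP[ii0 ciu]; exists (exist _ i ii0); rewrite ?inE.
by move=> [j]; rewrite inE => cju ->; rewrite cju (valP j).
Qed.

(** Cutting a ray according to its next edge. *)
Lemma vertex_count_out w n : irrational_past w ->
  vertex_count (uray w n) (out_mset (cV w n)).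
Proof.
move=> irr.
have -> : uray w n =
    \bigcup_(e in [set e | fsrc e == cV w n]) uray (ext w n e) (n + 1).
  apply/seteqP; split=> x.
    by move=> [h]; rewrite ray_split => -[e se hw <-]; exists e; last exists h.
  by move=> [e /= /eqP se [h /(ray_ext _ se)[hw _] <-]]; exists h.
apply: (additive_bigcup_fin (vertex_count0) vertex_countU) =>
  [e /eqP se|e e' x /eqP se /eqP se'].
- have irre := ext_irr se irr.
  apply: vertex_count_uray; exists (ext w n e), (n + 1) => //.
  by split=> //; rewrite -(ext_tgt se).
- move=> [h /(ray_ext _ se)[hw he] <-] [h' /(ray_ext _ se')[hw' he'] eh].
  by rewrite -he -he' (shift_orbit_inj_ray irr hw' hw eh).
Qed.

(** An out-split is realized inside the same beam by cutting one of its rays. *)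
Lemma vertex_count_split B (M N : mset) : out_split M N -> vertex_count B M ->
  vertex_count B N.
Proof.
move=> [X [v [-> ->]]].
move=> /vertex_count_extract[R [B' [[w [n [irr -> wn]]] dis -> cB']]].
rewrite addrC; apply: vertex_countU => //.
suff -> : v = cV w n by exact: vertex_count_out.
exact: val_inj.
Qed.

Lemma vertex_count_reach B (M N : mset) : reach M N -> vertex_count B M ->
  vertex_count B N.
Proof.
by elim=> [???|//|??? _ H _ H' /H/H' //]; exact: vertex_count_split.
Qed.

Lemma vertex_count_sub B (M N : mset) : vertex_count B (M + N) ->
  exists B', vertex_count B' M.
Proof.
elim/mset_ind: N B => [|N v IH] B; first by rewrite addr0; exists B.
by rewrite addrA => /vertex_count_extract[_ [B' [_ _ _ /IH]]].
Qed.

Lemma vertex_count_ubeam B (M : mset) : vertex_count B M -> is_ubeam B.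
Proof.
move=> [k [R [v [Rv _ -> _]]]]; exists k, R; split=> // i.
by case: (Rv i).
Qed.

End VertexCount.

(** * Existence of an irrational past *)

Lemma out_edge D (e0 : fedge D) (v : fvert D) :
  strongly_connected D -> exists e : fedge D, fsrc e = v.
Proof.
move=> conn; have /connectP[[|x q]] := conn v (fsrc e0); first by exists e0.
move=> /= /andP[/card_gt0P[e]]; rewrite inE => /andP[/eqP <- _] _ _.
by exists e.
Qed.

Section IrrationalPast.
Variable D : finDigraph.

Lemma biwalk_two_sided (b a : nat -> fedge D) :
  (forall k, ftgt (b k.+1) = fsrc (b k)) -> ftgt (b 0%N) = fsrc (a 0%N) ->
  (forall k, ftgt (a k) = fsrc (a k.+1)) ->
  exists h : biwalk D,
    (forall k, bE h (Posz k) = a k) /\ (forall k, bE h (Negz k) = b k).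
Proof.
move=> bP ba aP.
pose f i := match i with Posz k => a k | Negz k => b k end.
have [i|h hP] := @biwalk_of D f; last by exists h; split=> k; rewrite hP.
case: i => [k|[|k]].
- have -> : Posz k + 1 = Posz k.+1 by lia.
  exact: aP.
- exact: ba.
- have -> : Negz k.+1 + 1 = Negz k by lia.
  exact: bP.
Qed.

Hypothesis conn : strongly_connected D.
Variables e1 e2 : fedge D.
Hypotheses (e12 : e1 != e2) (tgt12 : ftgt e1 = ftgt e2).

(** Pasts are read from right to left: [back a b] says that [b] may precede
[a]. *)
Definition back : rel (fedge D) := fun a b => ftgt b == fsrc a.

Lemma back_path v (l : fedge D) :
  exists r, path back l r /\ fsrc (last l r) = v.
Proof.
have /connectP[p] := conn v (fsrc l).
elim: p v => [|x p IH] v /=; first by exists [::].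
move=> /andP[/card_gt0P[e]]; rewrite inE => /andP[/eqP se /eqP te].
move=> /IH h /h[r [pr lr]].
by exists (rcons r e); rewrite rcons_path last_rcons pr /back te lr eqxx.
Qed.

(** Two edges with the same target give two backward continuations of the same
length, and at least one of them disagrees with [y]. *)
Lemma back_avoid (l : fedge D) (y : nat -> fedge D) :
  exists r, [/\ path back l r, (0 < size r)%N & last l r != y (size r)].
Proof.
have [r [pr lr]] := back_path (ftgt e1) l.
have ext f : ftgt f = ftgt e1 -> path back l (rcons r f).
  by move=> tf; rewrite rcons_path pr /back tf lr eqxx.
have [ye|ye] := eqVneq e1 (y (size r).+1).
  exists (rcons r e2); rewrite size_rcons last_rcons; split=> //.
    exact: ext.
  by rewrite -ye eq_sym.
by exists (rcons r e1); rewrite size_rcons last_rcons; split=> //; exact: ext.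
Qed.

(** The past is built in stages, the stage with number [n] making it different
from the sequence of code [n] by [back_avoid]. *)
Lemma diagonal_past (T : countType) (x : T -> nat -> fedge D) :
  exists p : nat -> fedge D, (forall i, ftgt (p i.+1) = fsrc (p i)) /\
    forall t, exists i, p i != x t i.
Proof.
pose y n := if unpickle n is Some t then x t else fun=> e1.
have /choice[r rP] (sn : seq (fedge D) * nat) : exists r,
    [/\ path back (last e1 sn.1) r, (0 < size r)%N &
     last (last e1 sn.1) r != y sn.2 (size sn.1 + size r)%N].
  exact: back_avoid (fun k => y sn.2 (size sn.1 + k)%N).
(* [e1 :: S n] is the past after [n] stages *)
have [S [S0 SS]] : exists S : nat -> seq (fedge D),
    S 0%N = [::] /\ forall n, S n.+1 = S n ++ r (S n, n).
  by exists (fix S n := if n is m.+1 then S m ++ r (S m, m) else [::]).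
have pS n : path back e1 (S n).
  by elim: n => [|n IH]; rewrite ?S0 // SS cat_path IH; case: (rP (S n, n)).
have sS n : (n <= size (S n))%N.
  elim: n => [|n IH]; rewrite ?S0 // SS size_cat.
  by have [_ + _] := rP (S n, n); move: IH => /=; lia.
have mS n m : (n <= m)%N -> (size (S n) <= size (S m))%N.
  move=> /subnK <-; elim: (m - n)%N => [|d IH] //.
  by rewrite addSn SS size_cat (leq_trans IH) // leq_addr.
have nS n m i : (n <= m)%N -> (i <= size (S n))%N ->
    nth e1 (e1 :: S m) i = nth e1 (e1 :: S n) i.
  move=> /subnK <- iS; elim: (m - n)%N => [|d IH] //.
  rewrite addSn SS -IH -cat_cons nth_cat.
  have -> // : (i < size (e1 :: S (d + n)%N))%N.
  by rewrite ltnS (leq_trans iS) // mS // leq_addl.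
exists (fun i => nth e1 (e1 :: S i) i); split=> [i|t].
  rewrite -(nS i i.+1 i (leqnSn i) (sS i)).
  have /(pathP e1)/(_ i) := pS i.+1; rewrite sS => /(_ isT) /eqP.
  by rewrite /= => ->.
exists (size (S (pickle t).+1)).
have [_ s0] := rP (S (pickle t), pickle t).
rewrite -last_cat -SS /= -size_cat -SS /y pickleK.
apply: contra_neq => <-; rewrite (nS (pickle t).+1) ?sS //.
by rewrite -last_nth.
Qed.

(** An eventually periodic sequence is determined by the place [N] where
periodicity starts, a period [m] and its first [N + m] entries, so there are
countably many. *)
Lemma aperiodic_past : exists p : nat -> fedge D,
  (forall i, ftgt (p i.+1) = fsrc (p i)) /\
  forall N m, (0 < m)%N -> exists2 i, (N <= i)%N & p (i + m)%N != p i.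
Proof.
pose x (t : nat * nat * seq (fedge D)) i := let: (N, m, s) := t in
  nth e1 s (if (i < N)%N then i else N + (i - N) %% m)%N.
have [p [pP px]] := diagonal_past x.
exists p; split=> // N m m0; apply: contrapT => P.
have per i : (N <= i)%N -> p (i + m)%N = p i.
  by move=> Ni; apply/eqP; apply: contrapT => /negP ne; apply: P; exists i.
have perM i q : (N <= i)%N -> p (i + q * m)%N = p i.
  move=> Ni; elim: q => [|q IH]; first by rewrite addn0.
  by rewrite mulSn [(m + _)%N]addnC addnA per ?IH // (leq_trans Ni) // leq_addr.
have [i] := px (N, m, mkseq p (N + m)); rewrite /x.
case: ltnP => iN; first by rewrite nth_mkseq ?eqxx //; lia.
rewrite nth_mkseq ?ltn_add2l ?ltn_pmod //.
rewrite -(@perM (N + _)%N ((i - N) %/ m)%N) ?leq_addr //.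
by rewrite -addnA [(_ %% _ + _)%N]addnC -divn_eq subnKC // eqxx.
Qed.

Lemma irrational_biwalk : exists w : biwalk D, irrational_past w.
Proof.
have [p [pP pa]] := aperiodic_past.
have /choice[nxt nxtP] := fun l => out_edge e1 (ftgt l) conn.
have [|k|w [_ wp]] := @biwalk_two_sided p (fun k => iter k.+1 nxt (p 0%N)) pP.
- by rewrite nxtP.
- by rewrite /= nxtP.
exists w; apply: irrational_pastP => n k wk; apply: contrapT => /eqP k0.
have [|i Ni] := pa (`|n| + `|k|)%N `|k|%N; first lia.
rewrite -!wp => /eqP; apply.
have [k_gt0|k_lt0] := ltP 0 k.
  by rewrite -(wk (Negz (i + `|k|)%N)); [congr bE; lia|lia].
by rewrite -(wk (Negz i)); [congr bE; lia|lia].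
Qed.

End IrrationalPast.

(** * Weights in the presented group *)

Lemma ffun_free_gen (I : finType) (z : {ffun I -> int}) :
  z = \sum_i free_gen i *~ z i.
Proof.
apply/ffunP => j; rewrite sum_ffunE (bigD1 j) //= big1 => [|i ij].
  by rewrite ffunMzE ffunE eqxx addr0 intz.
by rewrite ffunMzE ffunE eq_sym (negPf ij) mul0rz.
Qed.

Section Lift.
Variable C : finDigraph.
Notation mset := {ffun fvert C -> nat}.
Implicit Types (a b M N : mset).

Definition intv M : {ffun fvert C -> int} := [ffun u => (M u)%:Z].

Lemma intvD M N : intv (M + N) = intv M + intv N.
Proof. by apply/ffunP => u; rewrite !ffunE PoszD. Qed.

Lemma intv_inj : injective intv.
Proof.
by move=> M N /ffunP e; apply/ffunP => u; have := e u; rewrite !ffunE => -[].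
Qed.

Lemma intv_single v : intv (single v) = free_gen v.
Proof. by apply/ffunP => u; rewrite !ffunE; case: eqP. Qed.

Lemma intv_sum M : intv M = \sum_u free_gen u *+ M u.
Proof.
rewrite [LHS]ffun_free_gen; by apply: eq_bigr => u _; rewrite ffunE.
Qed.

Lemma adj_sum (V : nmodType) (F : fvert C -> V) v :
  \sum_w F w *+ Adj v w = \sum_(e : fedge C | fsrc e == v) F (ftgt e).
Proof.
rewrite [RHS](partition_big (@ftgt C) xpredT) //=; apply: eq_bigr => w _.
rewrite /Adj -sum1_card -sumrMnr; apply: eq_big => [e|e]; rewrite inE //.
by move=> /andP[_ /eqP ->].
Qed.

Lemma intv_out v : intv (out_mset v) = \sum_w free_gen w *+ Adj v w.
Proof.
rewrite adj_sum /out_mset.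
rewrite (big_morph intv intvD (_ : intv 0 = 0)); last first.
  by apply/ffunP => u; rewrite !ffunE.
by apply: eq_bigr => e _; rewrite intv_single.
Qed.

(** Differences of multisets that become equivalent after adding a common
multiset. Asking for stable equivalence makes these a subgroup before
cancellation is available, and the subgroup contains the relators. *)
Definition stable_diff : {pred {ffun fvert C -> int}} :=
  fun z => `[< exists a b X, z = intv a - intv b /\ eqv (a + X) (b + X) >].

Lemma stable_diff_closed : zmod_closed stable_diff.
Proof.
split=> [|x y /asboolP[a [b [X [-> e]]]] /asboolP[c [d [Y [-> f]]]]];
  apply/asboolP.
  by exists 0, 0, 0; rewrite subrr; split=> //; exact: rst_refl.
exists (a + d), (b + c), (X + Y); split.
  by rewrite !intvD opprB opprD addrACA [X in _ + X]addrC.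
rewrite ![_ + (X + Y)]addrACA; apply: eqvD => //.
exact: rst_sym.
Qed.

HB.instance Definition _ :=
  GRing.isZmodClosed.Build _ stable_diff stable_diff_closed.

End Lift.

Section Presentation.
Local Open Scope quotient_scope.
Variable D : finDigraph.
Notation G := (ab_presentation (@UDAF_relators D)).
Notation gen := (ab_presentation_gen (@UDAF_relators D)).
Notation C := (core D).
Notation mset := {ffun fvert C -> nat}.
Implicit Types (M N : mset).

Definition weight M : G := \sum_u gen u *+ M u.

Lemma weightE M :
  weight M = \pi_({ideal_quot (subgroup_gen (@UDAF_relators D))}) (intv M).
Proof.
by rewrite intv_sum raddf_sum; apply: eq_bigr => u _; rewrite raddfMn.
Qed.

Lemma weightD M N : weight (M + N) = weight M + weight N.
Proof. by rewrite !weightE intvD raddfD. Qed.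

Lemma weight_single v : weight (single v) = gen v.
Proof. by rewrite weightE intv_single. Qed.

Lemma weight_eqP M N :
  weight M = weight N <-> intv M - intv N \in subgroup_gen (@UDAF_relators D).
Proof.
rewrite !weightE; split=> [/eqP|].
  by rewrite -Quotient.idealrBE.
by rewrite Quotient.idealrBE => /eqP.
Qed.

Lemma relator_stable (z : {ffun fvert C -> int}) :
  UDAF_relators z -> z \in @stable_diff C.
Proof.
move=> [v _ <-]; apply/asboolP; exists (out_mset v), (single v), 0.
rewrite intv_out intv_single addrC !addr0; split=> //.
exact/rst_sym/reach_eqv/reach_out.
Qed.

Lemma gen_split v : gen v = \sum_(e : fedge C | fsrc e == v) gen (ftgt e).
Proof.
rewrite -adj_sum -weight_single.
have -> : \sum_w gen w *+ Adj v w = weight (out_mset v).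
  rewrite weightE intv_out raddf_sum.
  by apply: eq_bigr => u _; rewrite raddfMn.
apply/esym/weight_eqP; rewrite intv_out intv_single addrC.
by apply/asboolP => S AS; apply: AS; exists v.
Qed.

Lemma sim_weight_eq M N : sim M N -> weight M = weight N.
Proof. exact: sim_weight gen_split _ _. Qed.

Hypothesis conn : strongly_connected C.
Variables e1 e2 : fedge C.
Hypotheses (e12 : e1 != e2) (src12 : fsrc e1 = fsrc e2).

(** Equal weights differ by a combination of relators, hence are stably
equivalent, and nonzero multisets cancel. *)
Lemma weight_eqv M N : M != 0 -> N != 0 -> weight M = weight N -> eqv M N.
Proof.
move=> M0 N0 /weight_eqP /asboolP/(_ _ relator_stable).
move=> /asboolP[a [b [X [e ab]]]].
apply: (eqv_cancel conn e12 src12 (X := b + X)) => //.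
have -> : M + (b + X) = N + (a + X).
  rewrite !addrA; congr (_ + _); apply: intv_inj; rewrite !intvD.
  move/eqP: e; rewrite subr_eq addrAC eq_sym subr_eq => /eqP <-.
  exact: addrC.
by apply: eqvD => //; exact: rst_refl.
Qed.

Variable w : biwalk D.
Hypothesis irr : irrational_past w.

(** One ray with central vertex [v] has pieces with all the central vertices
listed in [M], because [M] plus some surplus can be reached from [v]. *)
Lemma realize M : exists B, vertex_count B M.
Proof.
have [X _ rX] := reach_mset conn e12 src12 M (single_neq0 (cV w 0)).
apply: (@vertex_count_sub _ (uray w 0) _ X); apply: vertex_count_reach rX _.
by apply: vertex_count_uray; exists w, 0.
Qed.

Lemma eqv_sim M N : eqv M N -> sim M N.
Proof.
elim=> {M N} [M N MN|?|?? _ H|??? _ H _ H'];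
  [|exact: rst_refl|exact: rst_sym|exact: rst_trans H H'].
have [B BM] := realize M; apply: rst_step; exists B; split=> //.
  exact: vertex_count_ubeam BM.
exact: vertex_count_split MN BM.
Qed.

(** Opposites of generators are weights too: a neutral multiset [I], which has
weight zero, reaches [v + X] for some nonzero [X], and the weight of this [X] is
the opposite of the generator of [v]. *)
Lemma weight_surj (x : G) : exists2 M, M != 0 & weight M = x.
Proof.
have eqw M N : eqv M N -> weight M = weight N by move=> /eqv_sim/sim_weight_eq.
have [I I0 IP] := eqv_neutral conn e12 src12 (fsrc e1).
have wI : weight I = 0.
  have /eqw := IP I I0; rewrite weightD => /eqP.
  by rewrite addrC -subr_eq subrr eq_sym => /eqP.
pose P y := exists2 M, M != 0 & weight M = y.
have P0 : P 0 by exists I.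
have PD y z : P y -> P z -> P (y + z).
  move=> [M M0 <-] [N N0 <-]; exists (M + N); last exact: weightD.
  exact: mset_add_neq0r.
have Pgen v : P (gen v).
  by exists (single v); [exact: single_neq0|exact: weight_single].
have PNgen v : P (- gen v).
  have [X X0 /reach_eqv/eqw] := reach_mset conn e12 src12 (single v) I0.
  rewrite weightD wI weight_single => e; exists X => //.
  by apply/eqP; rewrite -addr_eq0 addrC -e.
have PMn y n : P y -> P (y *+ n).
  by move=> Py; elim: n => [|n IH]; rewrite ?mulrS //; exact: PD.
have -> : x = \sum_u gen u *~ (repr x u).
  rewrite -[LHS]reprK {1}(ffun_free_gen (repr x)) raddf_sum.
  by apply: eq_bigr => u _; rewrite raddfMz.
apply: (big_ind P) => // u _; case: (repr x u) => n.
  exact: PMn.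
by rewrite NegzE mulrNz -mulNrz; exact: PMn.
Qed.

End Presentation.

(** * Strongly connected UDAF digraphs *)

Section StronglyConnected.
Variable D : finDigraph.

Lemma forward_walk_unique (h h' : walk `[0, +oo[ D) : injective (@fsrc D) ->
  homV h (exist _ 0 isT) = homV h' (exist _ 0 isT) -> h = h'.
Proof.
move=> src_inj h0.
have eqE e : homV h (src e) = homV h' (src e) -> homE h e = homE h' e.
  move=> eV; apply: src_inj.
  by have /= -> := hom_src h e; have /= -> := hom_src h' e.
have eqV (k : nat) P :
    homV h (exist _ (Posz k) P) = homV h' (exist _ (Posz k) P).
  elim: k P => [|k IH] P; first by rewrite (bool_irrelevance P isT).
  have Pk : (Posz k \in `[0, +oo[) && (Posz k + 1 \in `[0, +oo[).
    by rewrite !in_itv /=; lia.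
  pose e : edge (Zdig `[0, +oo[) := exist _ (Posz k) Pk.
  have -> : exist _ (Posz k.+1) P = tgt e by apply: val_inj => /=; lia.
  by rewrite -!hom_tgt (eqE e) //; exact: IH.
apply: Hom_eq => [[[k|k] P]|e]; [exact: eqV|by []|].
by apply: eqE; case: (src e) => -[k|k] P; [exact: eqV|].
Qed.

Hypothesis conn : strongly_connected D.
Variable e0 : fedge D.

Lemma in_edge v : exists e : fedge D, ftgt e = v.
Proof.
have /connectP[q] := conn (ftgt e0) v; elim/last_ind: q => [|q x _].
  by move=> _ /= ->; exists e0.
rewrite rcons_path last_rcons => /andP[_ /card_gt0P[e]].
by rewrite inE => /andP[_ /eqP <-] ->; exists e.
Qed.

Lemma edge_core (e : fedge D) : in_coreE e.
Proof.
have /choice[nxt nxtP] := fun l => out_edge e0 (ftgt l) conn.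
have /choice[prv prvP] := fun l => in_edge (fsrc l).
have [k|||h [h0 _]] := @biwalk_two_sided D
  (fun k => iter k.+1 prv e) (fun k => iter k nxt e).
- by rewrite iterS prvP.
- exact: prvP.
- by move=> k; rewrite iterS nxtP.
- by exists h, 0; exact: h0.
Qed.

Definition core_edge (e : fedge D) : fedge (core D) :=
  exist _ e (asboolT (edge_core e)).

Lemma core_connected : strongly_connected (core D).
Proof.
move=> v w.
have /connectP[p] := conn (val v) (val w).
elim: p v => [|x p IH] v /=; first by move=> _ /val_inj ->.
move=> /andP[/card_gt0P[e]]; rewrite inE => /andP[/eqP se /eqP te] px wl.
have [tx sx] : val (ftgt (core_edge e)) = x /\ fsrc (core_edge e) = v.
  by split=> //; exact: val_inj.
apply: connect_trans (connect1 _) (IH (ftgt (core_edge e)) _ _);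
  rewrite ?tx //=.
by apply/card_gt0P; exists (core_edge e); rewrite inE sx !eqxx.
Qed.

Hypothesis udaf : UDAF D.

(** Otherwise the forward walk from a vertex would exist and be unique, which
the UDAF condition excludes. *)
Lemma out_branching : exists e1 e2 : fedge D, e1 != e2 /\ fsrc e1 = fsrc e2.
Proof.
apply: contrapT => nobranch.
have src_inj : injective (@fsrc D).
  move=> e1 e2 e12; apply/eqP; apply: contrapT => /negP ne.
  by apply: nobranch; exists e1, e2.
have [+ _] := udaf (fsrc e0); apply.
have [h [i hi]] := edge_core e0.
pose V (x : Zvert `[0, +oo[) := bV h (val x + i).
pose E (x : Zedge `[0, +oo[) := bE h (val x + i).
have sP (e : edge (Zdig `[0, +oo[)) : @src D (E e) = V (src e) by exact: src_bE.
have tP (e : edge (Zdig `[0, +oo[)) : @tgt D (E e) = V (tgt e).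
  by rewrite /= tgt_bE /V /= addrAC.
have g0 : V (exist _ 0 isT) = fsrc e0 by rewrite /V /= add0r -src_bE /bE hi.
exists (@MkHom (Zdig `[0, +oo[) D V E sP tP); split=> // h' h'0.
by apply: forward_walk_unique; rewrite // h'0.
Qed.

(** By counting: every vertex has an outgoing edge and one has two, so there are
more edges than vertices and the target map is not injective. *)
Lemma in_branching : exists e1 e2 : fedge D, e1 != e2 /\ ftgt e1 = ftgt e2.
Proof.
have [e1 [e2 [e12 src12]]] := out_branching.
have /choice[f fP] := fun v => out_edge e0 v conn.
have f_inj : injective f by move=> v w fvw; rewrite -(fP v) fvw fP.
have : (#|fvert D| < #|fedge D|)%N.
  rewrite ltnNge; apply/negP => le_EV.
  have /codomP[v1 ev1] := inj_card_onto f_inj le_EV e1.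
  have /codomP[v2 ev2] := inj_card_onto f_inj le_EV e2.
  by move/eqP: e12; apply; move: src12; rewrite ev1 ev2 !fP => ->.
rewrite ltnNge => /negP lt; apply: contrapT => nobranch; apply: lt.
apply: (leq_card (@ftgt D)) => a b ab; apply/eqP; apply: contrapT => /negP ne.
by apply: nobranch; exists a, b.
Qed.

End StronglyConnected.

(** * The dimension semigroup *)

Lemma dim_class_eq D (M N : MS D) :
  dim_class M = dim_class N <-> sim (val M) (val N).
Proof. by split=> [/eqmodP/asboolP //|s]; apply/eqmodP; exact/asboolP. Qed.

Theorem theorem6p8 (D : finDigraph) (hD : UDAF D)
    (hconn : strongly_connected D) :
  ((0 < #|fedge D|)%N ->
    exists op : dim_semigroup D -> dim_semigroup D -> dim_semigroup D,
      [/\ quotient_add op,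
          is_abelian_group op &
          exists f : ab_presentation (@UDAF_relators D) -> dim_semigroup D,
            [/\ bijective f,
                {morph f : x y / x + y >-> op x y} &
                forall v : fvert (core D),
                  f (ab_presentation_gen (@UDAF_relators D) v)
                    = dim_class (indic v)]]) /\
  (#|fedge D| = 0%N -> dim_semigroup D -> False).
Proof.
split; last first.
  move=> E0 x; have [M M0] := repr x; move/eqP: M0; apply.
  apply/ffunP => -[v vP]; exfalso; have /asboolP[h [i _]] := vP.
  exact: (fintype0 (homE h (biE i) : fedge D) E0).
move=> /card_gt0P[e0 _].
have conn := core_connected hconn e0.
have [e1 [e2 [e12 src12]]] := out_branching hconn e0 hD.
have [a1 [a2 [a12 tgt12]]] := in_branching hconn e0 hD.
have [w irr] := irrational_biwalk hconn a12 tgt12.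
have c12 : core_edge hconn e0 e1 != core_edge hconn e0 e2 by [].
have csrc : fsrc (core_edge hconn e0 e1) = fsrc (core_edge hconn e0 e2).
  exact: val_inj.
have inj M N : M != 0 -> N != 0 -> @weight D M = weight N -> sim M N.
  by move=> M0 N0 /(weight_eqv conn c12 csrc M0 N0)/(eqv_sim conn c12 csrc irr).
have surj := weight_surj conn c12 csrc irr.
(* the weight passes to the quotient, and [g] is the resulting bijection onto
   the presented group; the group structure is transported along it *)
pose g (x : dim_semigroup D) := weight (val (repr x)).
have gE M : g (dim_class M) = weight (val M).
  by apply: sim_weight_eq; apply/dim_class_eq; rewrite /dim_class reprK.
have classE (x : dim_semigroup D) : x = dim_class (repr x).
  by rewrite /dim_class reprK.
have g_inj : injective g.
  move=> x y; rewrite (classE x) (classE y) !gE => e; apply/dim_class_eq.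
  exact: inj (svalP (repr x)) (svalP (repr y)) e.
have /choice[f fP] x : exists y, g y = x.
  have [M M0 <-] := surj x.
  by exists (dim_class (exist _ M M0 : MS D)); rewrite gE.
have gK : cancel g f by move=> x; apply: g_inj; rewrite fP.
exists (fun x y => f (g x + g y)); split.
- by move=> M N; apply: g_inj; rewrite fP !gE -weightD.
- exists (f 0), (fun x => f (- g x)); split=> [x y z|x y|x|x].
  + by rewrite !fP addrA.
  + by rewrite addrC.
  + by rewrite fP add0r gK.
  + by rewrite fP addNr.
exists f; split; first by exists g.
- by move=> x y; rewrite !fP.
- by move=> v; apply: g_inj; rewrite fP gE weight_single.
Qed.
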